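(* Let $K$ be an infinite field, let $n\ge 1$, and let $S=K[x_1,\dots,x_n]$. Let $\mathcal F\subset P_n$ be a nonempty lower filter with respect to the dominance order, and let $$G_{\mathcal F}=\Big\{ f_T \;\Big|\; T\in \bigcup_{\lambda\in\mathcal F}\mathrm{Tab}(\lambda)\Big\}.$$ Then: (1) $I_{\mathcal F}=J_{P_n\setminus\mathcal F}$; in particular, $I_{\mathcal F}$ is reduced (i.e. a radical ideal). (2) $G_{\mathcal F}$ is a universal Gröbner basis for $I_{\mathcal F}$.
   Context: Partitions and dominance order: a partition of a positive integer $n$ is a non-increasing sequence of positive integers $\lambda=(\lambda_1,\dots,\lambda_m)$ with $\lambda_1+\cdots+\lambda_m=n$; $P_n$ is the set of all partitions of $n$. For $\lambda=(\lambda_1,\dots,\lambda_m)$ and $\mu=(\mu_1,\dots,\mu_l)$ in $P_n$, write $\lambda\unrhd\mu$ (equivalently $\mu\unlhd\lambda$) if $\lambda_1+\cdots+\lambda_k\ge\mu_1+\cdots+\mu_k$ for all $k=1,\dots,\min\{m,l\}$ (dominance order). A subset $\mathcal F\subset P_n$ is a lower filter if $\lambda\in\mathcal F$, $\mu\in P_n$ and $\mu\unlhd\lambda$ imply $\mu\in\mathcal F$. Tableaux and Specht polynomials: a tableau of shape $\lambda\in P_n$ is a bijective filling of the Young diagram of $\lambda$ (with rows of lengths $\lambda_1,\lambda_2,\dots$ from top to bottom, left-justified) by the integers $1,\dots,n$; $\mathrm{Tab}(\lambda)$ is the set of all tableaux of shape $\lambda$. The Specht polynomial $f_T\in S$ of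 $T\in\mathrm{Tab}(\lambda)$ is the product of all $x_i-x_j$ such that $i$ and $j$ are in the same column of $T$ and $j$ is in a lower position than $i$ (an empty product is $1$). Ideals: $I_\lambda$ is the ideal of $S$ generated by all $f_T$ with $T\in\mathrm{Tab}(\lambda)$, and $I_{\mathcal F}=\sum_{\lambda\in\mathcal F}I_\lambda$. For $\boldsymbol a\in K^n$, the orbit type $\Lambda(\boldsymbol a)\in P_n$ is the partition obtained by sorting in non-increasing order the multiplicities with which the distinct values occur among the coordinates of $\boldsymbol a$ (e.g. $\Lambda((4,0,2,4,2,4))=(3,2,1)$); equivalently, the stabilizer of $\boldsymbol a$ in the symmetric group $\mathfrak S_n$ permuting coordinates is isomorphic to $\mathfrak S_{\mu_1}\times\cdots\times\mathfrak S_{\mu_r}$ with $\mu=\Lambda(\boldsymbol a)$. For $\mu\in P_n$ put $H_\mu=\{\boldsymbol a\in K^n\mid\Lambda(\boldsymbol a)=\mu\}$, and for any subset $\mathcal G\subset P_n$ put $J_{\mathcal G}=\{f\in S\mid f(\boldsymbol a)=0\text{ for all }\boldsymbol a\in\bigcup_{\mu\in\mathcal G}H_\mu\}$ (so $J_\emptyset=S$). Gröbner bases: for a monomial order $<$ on $S$, $\mathrm{in}_<(f)$ is the initial monomial of $f$. A finite subset $G$ of an ideal $I\subset S$ is a Gröbner basis of $I$ with respect to $<$ if the ideal $\langle\mathrm{in}_<(f)\mid 0\ne f\in I\rangle$ is generated by $\{\mathrm{in}_<(g)\mid g\in G\}$; it is a universal Gröbner basis of $I$ if it is a Gröbner basis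 of $I$ with respect to every monomial order on $S$. *)

(* Defs.v *)
From HB Require Import structures.
From mathcomp Require Import all_boot all_order all_algebra.
From mathcomp Require Import mpoly.

Set Implicit Arguments.
Unset Strict Implicit.
Unset Printing Implicit Defensive.

Import GRing.Theory.
Local Open Scope ring_scope.

Definition is_partition (n : nat) (s : seq nat) : bool :=
  [&& sorted geq s, 0%N \notin s & sumn s == n].

Record partition_of (n : nat) : predArgType :=
  Partition { parts :> seq nat; partsP : is_partition n parts }.

HB.instance Definition _ n := [isSub for @parts n].
HB.instance Definition _ n := [Countable of partition_of n by <:].

Section PartitionFinite.
Variable n : nat.

Let to_bseq (lam : partition_of n) : n.-bseq 'I_n.+1 :=
  insub_bseq n (map inord lam).
Let of_bseq (b : n.-bseq 'I_n.+1) : option (partition_of n) :=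
  insub (map val b).

Lemma size_partition (lam : partition_of n) : (size lam <= n)%N.
Proof.
case: lam => s /=; case/and3P=> _ s0 /eqP <-.
elim: s s0 => //= x s IHs; rewrite inE negb_or eq_sym -lt0n.
by case/andP=> x0 /IHs; rewrite -add1n; apply: leq_add.
Qed.

Lemma leq_part (lam : partition_of n) x : x \in (lam : seq nat) -> (x <= n)%N.
Proof.
case: lam => s /=; case/and3P=> _ _ /eqP <-.
elim: s => //= y s IHs; rewrite inE => /predU1P[->|/IHs le_x].
  exact: leq_addr.
exact: leq_trans le_x (leq_addl _ _).
Qed.

Lemma to_bseqK : pcancel to_bseq of_bseq.
Proof.
move=> lam; rewrite /of_bseq /to_bseq /insub_bseq val_insubd size_map.
rewrite size_partition -map_comp.
rewrite (_ : map _ lam = parts lam) ?valK // -[RHS]map_id.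
by apply/eq_in_map => x /leq_part le_x /=; rewrite inordK.
Qed.

HB.instance Definition _ : isFinite (partition_of n) := PCanIsFinite to_bseqK.
End PartitionFinite.

Definition dominates (n : nat) (lam mu : partition_of n) : bool :=
  [forall k : 'I_(minn (size lam) (size mu)),
     (sumn (take k.+1 mu) <= sumn (take k.+1 lam))%N].

Definition lower_filter (n : nat) (F : {set partition_of n}) : Prop :=
  forall lam mu, lam \in F -> dominates lam mu -> mu \in F.

(* Rows, columns and entries are numbered from 0. *)
Definition cell (n : nat) (lam : partition_of n) : finType :=
  {i : 'I_(size lam) & 'I_(nth 0%N lam i)}.

Definition cell_row n (lam : partition_of n) (c : cell lam) : nat := tag c.
Definition cell_col n (lam : partition_of n) (c : cell lam) : nat := tagged c.

Definition Tab (n : nat) (lam : partition_of n) :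
    {set {ffun cell lam -> 'I_n}} :=
  [set T : {ffun cell lam -> 'I_n} |
     injectiveb T && [forall i, exists c, T c == i]].

Definition specht (K : fieldType) (n : nat) (lam : partition_of n)
    (T : {ffun cell lam -> 'I_n}) : {mpoly K[n]} :=
  \prod_(c : cell lam)
    \prod_(d : cell lam | (cell_col c == cell_col d)
                          && (cell_row c < cell_row d)%N)
      ('X_(T c) - 'X_(T d)).

Definition is_ideal (R : comNzRingType) (I : R -> Prop) : Prop :=
  [/\ I 0, forall f g, I f -> I g -> I (f + g) & forall h f, I f -> I (h * f)].

Definition is_radical_ideal (R : comNzRingType) (I : R -> Prop) : Prop :=
  is_ideal I /\ forall f k, I (f ^+ k) -> I f.

Definition ideal_gen (R : comNzRingType) (A : R -> Prop) (f : R) : Prop :=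
  exists2 s : seq (R * R),
    (forall hg, hg \in s -> A hg.2) & f = \sum_(hg <- s) hg.1 * hg.2.

Definition specht_ideal (K : fieldType) (n : nat) (lam : partition_of n) :
    {mpoly K[n]} -> Prop :=
  ideal_gen (fun f => exists2 T, T \in Tab lam & f = specht K T).
Arguments specht_ideal K {n} lam f.

Definition filter_ideal (K : fieldType) (n : nat) (F : {set partition_of n}) :
    {mpoly K[n]} -> Prop := fun f =>
  exists2 q : partition_of n -> {mpoly K[n]},
    (forall lam, lam \in F -> specht_ideal K lam (q lam))
    & f = \sum_(lam in F) q lam.
Arguments filter_ideal K {n} F f.

Definition multiplicities (n : nat) (K : fieldType) (a : 'I_n -> K) : seq nat :=
  [seq count_mem x (codom a) | x <- undup (codom a)].

Lemma orbit_type_subproof (n : nat) (K : fieldType) (a : 'I_n -> K) :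
  is_partition n (sort geq (multiplicities a)).
Proof.
apply/and3P; split.
- by apply: sort_sorted => x y; apply: leq_total.
- rewrite mem_sort; apply/mapP => -[x]; rewrite mem_undup -has_pred1 has_count.
  by move=> + E; rewrite -E.
- have /permPl/perm_sumn -> := perm_sort geq (multiplicities a).
  have /perm_size := perm_count_undup (codom a).
  rewrite size_codom card_ord size_flatten => /eqP.
  by rewrite /shape -map_comp (eq_map (g := fun x => count_mem x (codom a))) //
     => x; rewrite /= size_nseq.
Qed.

Definition orbit_type (n : nat) (K : fieldType) (a : 'I_n -> K) :
  partition_of n := Partition (orbit_type_subproof a).

Definition vanishing_ideal (K : fieldType) (n : nat)
    (G : {set partition_of n}) : {mpoly K[n]} -> Prop := fun f =>
  forall mu, mu \in G -> forall a : 'I_n -> K, orbit_type a = mu -> f.@[a] = 0.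
Arguments vanishing_ideal K {n} G f.

Record monomial_order (n : nat) (le : rel 'X_{1..n}) : Prop := MonomialOrder {
  mo_refl : reflexive le;
  mo_anti : antisymmetric le;
  mo_trans : transitive le;
  mo_total : total le;
  mo_min : forall m, le 0%MM m;
  mo_add : forall m m1 m2, le m1 m2 -> le (m + m1)%MM (m + m2)%MM }.

(* Analogue of [mlead] for an arbitrary monomial order; only meaningful for
   nonzero polynomials (its value at 0 is the junk value 0%MM). *)
Definition init_mnm (n : nat) (K : fieldType) (le : rel 'X_{1..n})
    (f : {mpoly K[n]}) : 'X_{1..n} :=
  \big[(fun m1 m2 => if le m1 m2 then m2 else m1)/0%MM]_(m <- msupp f) m.

Definition init_ideal (n : nat) (K : fieldType) (le : rel 'X_{1..n})
    (A : {mpoly K[n]} -> Prop) : {mpoly K[n]} -> Prop :=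
  ideal_gen (fun p => exists2 f, A f /\ f != 0 & p = 'X_[init_mnm le f]).

Definition groebner_basis (n : nat) (K : fieldType) (le : rel 'X_{1..n})
    (I : {mpoly K[n]} -> Prop) (G : seq {mpoly K[n]}) : Prop :=
  (forall g, g \in G -> I g) /\
  (forall p, init_ideal le I p <-> init_ideal le (fun g => g \in G) p).

Definition universal_groebner_basis (n : nat) (K : fieldType)
    (I : {mpoly K[n]} -> Prop) (G : seq {mpoly K[n]}) : Prop :=
  forall le, monomial_order le -> groebner_basis le I G.

Definition specht_basis (K : fieldType) (n : nat) (F : {set partition_of n}) :
    seq {mpoly K[n]} :=
  [seq specht K T | lam <- enum F, T <- enum (Tab lam)].

Definition infinite_field (K : fieldType) : Prop :=
  forall s : seq K, exists x, x \notin s.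

(* Main.v *)
Require Import Defs.
From mathcomp Require Import all_boot all_order all_algebra.
From mathcomp Require Import mpoly.
From mathcomp Require Import perm zify ring.

(** Why the theorem holds.  Write L_t(s) for the number of cells in the first t
    columns of the diagram with row lengths s.  A partition lam dominates mu
    as soon as L_t(lam) <= L_t(mu) for all t.  The numbers L_t ignore the
    order of the rows, and a new cell in column v (columns counted from 0)
    just adds 1 to L_t for every t > v.

    If f_T does not vanish at a point a, each value of a occurs at most once
    per column of T.  This bounds L_t of the shape of T by L_t of the orbit
    type of a, so the shape dominates the orbit type
    ([specht_eval_neq0]).  Hence the ideal generated by F is contained in the
    vanishing ideal J of the orbit types outside F.

    The heart of the proof is [vanishing_has_specht_monomial]: some monomial
    of every nonzero f in J is divisible by the initial monomial of some f_T
    with shape in F.  By induction on the number of variables, consider f as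
    a polynomial of degree d in its last variable z, with leading coefficient
    g.  Let a have orbit type mu, and let z be an element of K whose
    multiplicity in a, possibly 0, is at least mu_d (rows are counted from 0).
    Appending z to a yields an orbit type that dominates mu with a cell added
    to a row of length mu_d.
    If that partition is not in F, f(a, z) vanishes for all these z.  There
    are more than d of them, so g(a) = 0.  Thus g is in the ideal J of the
    filter of those mu whose extension by such a cell is in F, and induction
    yields a tableau T' of shape mu in this filter.  Adding the last entry to
    T' in column mu_d creates a tableau T.  At most d cells lie above the new
    one, because column mu_d of mu has at most d cells, so the initial
    monomial of f_T divides that of f_T' times z^d.

    The initial monomial of f_T depends only on the column of each entry and
    on the order which the monomial order induces on the variables
    ([specht_mnm]).  After a permutation of the variables, the result above
    says for every monomial order that no nonzero element of J is a
    combination of standard monomials, that is, of those divisible by no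
    initial monomial of a generator.  Division by the f_T reduces each f to a
    combination of standard monomials ([normal_form]).  For f in J the result
    is 0, so f is in the ideal generated by the f_T.  And if the initial
    monomial of f were standard, it would survive the division
    ([init_nonstd]).  So the f_T form a Groebner basis for every order. *)

Set Implicit Arguments.
Unset Strict Implicit.
Unset Printing Implicit Defensive.

Import GRing.Theory.

(** * Column heights and majorization *)

Definition first_columns (s : seq nat) (t : nat) : nat :=
  \sum_(x <- s) minn x t.

Definition column_height (s : seq nat) (c : nat) : nat :=
  count (fun x => c < x) s.

Lemma first_columnsS s t :
  first_columns s t.+1 = first_columns s t + column_height s t.
Proof.
rewrite /first_columns /column_height -sum1_count [X in _ + X]big_mkcond.
rewrite -big_split /=.
by apply: eq_bigr => x _; case: ifP => /=; lia.
Qed.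

Lemma first_columns_perm s1 s2 t :
  perm_eq s1 s2 -> first_columns s1 t = first_columns s2 t.
Proof. exact: perm_big. Qed.

(** The dominance order read off the columns: the partition with the longer
    first rows is the one with fewer cells in the first columns. *)
Definition majorizes (s1 s2 : seq nat) : Prop :=
  forall t, first_columns s1 t <= first_columns s2 t.

Lemma sorted_geq_nth (s : seq nat) i j :
  sorted geq s -> i <= j -> nth 0 s j <= nth 0 s i.
Proof.
move=> s_sorted le_ij; have [lt_js|] := ltnP j (size s); last first.
  by move=> le_sj; rewrite (nth_default _ le_sj).
have geq_trans : transitive geq.
  by move=> x y z /= h1 h2; apply: leq_trans h2 h1.
have := sorted_leq_nth geq_trans leqnn 0 s_sorted.
by apply; rewrite ?inE //; apply: leq_ltn_trans lt_js.
Qed.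

Lemma sorted_partition n (lam : partition_of n) : sorted geq lam.
Proof. by have /and3P[] := partsP lam. Qed.

Lemma sumn_partition n (lam : partition_of n) : sumn lam = n.
Proof. by have /and3P[_ _ /eqP] := partsP lam. Qed.

(** Let t be the length of row k.  In lam the first k + 1 rows reach column t
    and the later ones do not go beyond it, so L_t(lam) is exactly
    (k + 1) t plus the size of the later rows.  For mu this is an upper bound.
    Hence mu has at least as many cells as lam below row k. *)
Lemma majorizes_dominates n (lam mu : partition_of n) :
  majorizes lam mu -> dominates lam mu.
Proof.
move=> le_lm; apply/forallP=> -[k /=]; rewrite leq_min => /andP[lt_kl _].
set t := nth 0 lam k.
have split_sum (s : seq nat) j : sumn s = sumn (take j s) + sumn (drop j s).
  by rewrite -sumn_cat cat_take_drop.
have fc_cat s1 s2 :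
    first_columns (s1 ++ s2) t = first_columns s1 t + first_columns s2 t.
  by rewrite /first_columns big_cat.
have size_tk : size (take k.+1 lam) = k.+1 by rewrite size_takel.
have Elam : first_columns lam t = k.+1 * t + sumn (drop k.+1 lam).
  rewrite -{1}[parts lam](cat_take_drop k.+1) fc_cat; congr (_ + _).
    rewrite /first_columns (eq_big_seq (fun=> t)).
      by rewrite big_const_seq count_predT size_tk iter_addn_0 mulnC.
    move=> x /(nthP 0)[i]; rewrite size_tk => lt_i <-.
    rewrite nth_take //; apply/minn_idPr.
    exact: sorted_geq_nth (sorted_partition lam) _.
  rewrite /first_columns sumnE; apply: eq_big_seq => x /(nthP 0)[i _ <-].
  rewrite nth_drop; apply/minn_idPl.
  by apply: sorted_geq_nth (sorted_partition lam) _; lia.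
have le_sumn s : first_columns s t <= sumn s.
  by rewrite sumnE; apply: leq_sum => x _; apply: geq_minl.
have le_size s : first_columns s t <= size s * t.
  rewrite -sum1_size big_distrl /=; apply: leq_sum => x _.
  by rewrite mul1n; apply: geq_minr.
have Emu : first_columns mu t <= k.+1 * t + sumn (drop k.+1 mu).
  rewrite -{1}[parts mu](cat_take_drop k.+1) fc_cat leq_add //.
  apply: leq_trans (le_size _) _.
  by rewrite leq_mul2r size_take_min geq_minl orbT.
have := le_lm t; have := sumn_partition lam; have := sumn_partition mu.
have := split_sum lam k.+1; have := split_sum mu k.+1.
by lia.
Qed.

(** A row of length v becomes v + 1.  If v = 0 is not in s, [rem] does nothing
    and a new row of length 1 appears. *)
Definition add_cell (s : seq nat) (v : nat) : seq nat :=
  sort geq (v.+1 :: rem v s).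

Lemma first_columns_add_cell s v t : (v == 0) || (v \in s) ->
  first_columns (add_cell s v) t = first_columns s t + (v < t).
Proof.
move=> v_ok; have -> : first_columns (add_cell s v) t =
    first_columns (v.+1 :: rem v s) t.
  by apply: first_columns_perm; rewrite perm_sort.
rewrite /first_columns big_cons; have [vs|vs] := boolP (v \in s).
  by rewrite [in RHS](big_rem v vs) /=; lia.
rewrite rem_id //; move: v_ok; rewrite (negbTE vs) orbF => /eqP ->; lia.
Qed.

Lemma column_height_add_cell s v c : (v == 0) || (v \in s) ->
  column_height (add_cell s v) c = column_height s c + (v == c).
Proof.
move=> v_ok; have := first_columnsS (add_cell s v) c.
rewrite !first_columns_add_cell // first_columnsS.
by case: (ltngtP v c) => //=; lia.
Qed.

Lemma nth_row_or0 n (mu : partition_of n) d :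
  (nth 0 mu d == 0) || (nth 0 mu d \in (mu : seq nat)).
Proof.
by have [/mem_nth->|/(nth_default 0)->] := ltnP d (size mu); rewrite ?orbT.
Qed.

Lemma add_cell_partition n (mu : partition_of n) d :
  is_partition n.+1 (add_cell mu (nth 0 mu d)).
Proof.
have := nth_row_or0 mu d; set v := nth 0 mu d => v_ok.
apply/and3P; split.
- by apply: sort_sorted => x y; apply: leq_total.
- rewrite mem_sort inE /=; apply/negP => /mem_rem.
  by have /and3P[_ /negbTE->] := partsP mu.
- have /permPl/perm_sumn -> := perm_sort geq (v.+1 :: rem v mu).
  rewrite /= -[in X in _ == X](sumn_partition mu).
  have [vs|vs] := boolP (v \in (mu : seq nat)).
    by rewrite (perm_sumn (perm_to_rem vs)) /= addSn.
  by rewrite rem_id //; move: v_ok; rewrite (negbTE vs) orbF => /eqP ->.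
Qed.

Definition add_cell_row n (mu : partition_of n) d : partition_of n.+1 :=
  Partition (add_cell_partition mu d).

Lemma column_height_gt n (mu : partition_of n) d c :
  (d < column_height mu c) = (c < nth 0 mu d).
Proof.
have [lt_c|le_c] := ltnP c (nth 0 mu d).
  rewrite -[parts mu](cat_take_drop d.+1) /column_height count_cat.
  have lt_d : d < size mu.
    by rewrite ltnNge; apply/negP => /(nth_default 0) E; rewrite E in lt_c.
  apply: leq_trans (leq_addr _ _).
  have sz : size (take d.+1 mu) = d.+1 by rewrite size_takel.
  rewrite -{1}sz; apply/eq_leq/esym/eqP; rewrite -all_count.
  apply/allP => x /(nthP 0)[i]; rewrite size_takel // => lt_i <-.
  rewrite nth_take //; apply: leq_trans lt_c _.
  exact: sorted_geq_nth (sorted_partition mu) _.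
apply/negbTE; rewrite -leqNgt -[parts mu](cat_take_drop d) /column_height count_cat.
rewrite [X in _ + X](_ : _ = 0) ?addn0.
  by apply: leq_trans (count_size _ _) _; rewrite size_take_min geq_minl.
apply/eqP; rewrite -leqn0 leqNgt -has_count; apply/hasPn => x /(nthP 0)[i _ <-].
rewrite nth_drop -leqNgt; apply: leq_trans le_c.
by apply: sorted_geq_nth (sorted_partition mu) _; lia.
Qed.

(** The inequality at t + 1 can only fail if L_(t+1) agrees for mu and nu while
    column t has more than d cells in nu and at most d in mu.  Then L_t would
    be larger for mu than for nu. *)
Lemma majorizes_add_cell n (mu nu : partition_of n) d :
  majorizes mu nu -> majorizes (add_cell_row mu d) (add_cell_row nu d).
Proof.
move=> le_mn t; rewrite !first_columns_add_cell ?nth_row_or0 //.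
have le_t := le_mn t; case: t le_t => [|t] le_t; first by rewrite !ltn0; lia.
have := le_mn t; move: le_t; rewrite !first_columnsS.
have := column_height_gt mu d t; have := column_height_gt nu d t.
by case: (ltngtP t (nth 0 mu d)); case: (ltngtP t (nth 0 nu d)) => /=; lia.
Qed.

(** * Orbit types *)

(** Used for points, exponents of monomials and columns of entries alike. *)
Definition extend (T : Type) n (a : 'I_n -> T) (z : T) (i : 'I_n.+1) : T :=
  oapp a z (unlift ord_max i).

Lemma extend_max (T : Type) n (a : 'I_n -> T) z : extend a z ord_max = z.
Proof. by rewrite /extend unlift_none. Qed.

Lemma extend_widen (T : Type) n (a : 'I_n -> T) z i :
  extend a z (widen_ord (leqnSn n) i) = a i.
Proof.
rewrite /extend (_ : widen_ord _ i = lift ord_max i) ?liftK //.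
by apply: val_inj; rewrite /= /bump leqNgt ltn_ord.
Qed.

Definition multiplicity (T : eqType) n (a : 'I_n -> T) (x : T) : nat :=
  \sum_i (a i == x).

Lemma multiplicity_extend (T : eqType) n (a : 'I_n -> T) z x :
  multiplicity (extend a z) x = multiplicity a x + (z == x).
Proof.
rewrite /multiplicity big_ord_recr /= extend_max; congr (_ + _).
by apply: eq_bigr => i _; rewrite extend_widen.
Qed.

Section OrbitType.
Variable K : fieldType.

Lemma count_codom n (a : 'I_n -> K) x :
  count_mem x (codom a) = multiplicity a x.
Proof.
rewrite /multiplicity codomE count_map -sum1_count big_mkcond /= big_enum /=.
by apply: eq_bigr => i _; case: eqP.
Qed.

(** Summing over any list that contains the values makes it possible to
    compare the orbit types of points with different sets of values. *)
Lemma first_columns_orbit n (a : 'I_n -> K) (U : seq K) t :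
    uniq U -> {subset codom a <= U} ->
  first_columns (orbit_type a) t = \sum_(x <- U) minn (multiplicity a x) t.
Proof.
move=> uniqU sub_aU; have -> : first_columns (orbit_type a) t =
    first_columns (multiplicities a) t.
  by apply: first_columns_perm; rewrite perm_sort.
rewrite /first_columns /multiplicities big_map.
under eq_bigr => x _ do rewrite count_codom.
rewrite [RHS](bigID (fun x => x \in codom a)) /= [X in _ + X]big1_seq ?addn0.
  rewrite -[RHS]big_filter; apply: perm_big; apply: uniq_perm.
  - exact: undup_uniq.
  - exact: filter_uniq.
  move=> x; rewrite mem_undup mem_filter andbC; case: (boolP (x \in U)) => //.
  by apply: contraNF => /sub_aU.
move=> x /andP[x_a _]; rewrite -count_codom.
by move/count_memPn: x_a => ->; rewrite min0n.
Qed.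

Lemma orbit_type_mem n (a : 'I_n -> K) v : v \in (orbit_type a : seq nat) ->
  exists x, multiplicity a x = v.
Proof.
by rewrite /= mem_sort => /mapP[x _ ->]; exists x; rewrite -count_codom.
Qed.

Lemma first_columns_extend n (a : 'I_n -> K) z t :
  first_columns (orbit_type (extend a z)) t =
  first_columns (orbit_type a) t + (multiplicity a z < t).
Proof.
pose U := undup (z :: codom a).
have uU : uniq U by apply: undup_uniq.
have zU : z \in U by rewrite mem_undup mem_head.
have aU : {subset codom a <= U} by move=> x xa; rewrite mem_undup inE xa orbT.
rewrite !(@first_columns_orbit _ _ U) //; last first.
  move=> x /codomP[i ->]; rewrite /extend; case: unlift => //= j.
  by apply/aU/codom_f.
rewrite !(bigD1_seq z) //= multiplicity_extend eqxx addn1.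
rewrite (eq_bigr (fun x => minn (multiplicity a x) t)).
  by set S := \sum_(i <- U | _) _; move: S; case: ltnP => /=; lia.
by move=> x; rewrite multiplicity_extend eq_sym => /negbTE ->; rewrite addn0.
Qed.

Lemma orbit_type_perm n (a : 'I_n -> K) (s : 'S_n) :
  orbit_type (a \o s) = orbit_type a.
Proof.
have pa : perm_eq (codom (a \o s)) (codom a).
  apply/allP => x _ /=; rewrite !count_codom; apply/eqP.
  by rewrite [RHS](reindex_inj (@perm_inj _ s)).
apply: val_inj => /=; apply/perm_sort_inP.
  by move=> x y _ _; apply: leq_total.
  by move=> y x z _ _ _ /= h1 h2; apply: leq_trans h2 h1.
  by move=> x y _ _ /= h; apply/eqP; rewrite eqn_leq andbC.
rewrite /multiplicities (eq_map (g := fun x => count_mem x (codom a))).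
  apply: perm_map; apply: uniq_perm; rewrite ?undup_uniq // => x.
  by rewrite !mem_undup (perm_mem pa).
by move=> x; apply/seq.permP.
Qed.

End OrbitType.

(** * Cells and tableaux *)

Section Cells.
Variables (n : nat) (lam : partition_of n).
Implicit Types (c d : cell lam).

Lemma cell_inj c d : cell_row c = cell_row d -> cell_col c = cell_col d -> c = d.
Proof.
case: c d => [i j] [i' j']; rewrite /cell_row /cell_col /= => /val_inj Ei.
by case: i' / Ei j' => j' /val_inj ->.
Qed.

Lemma cell_in c : cell_col c < nth 0 lam (cell_row c).
Proof. exact: ltn_ord (tagged c). Qed.

Lemma sum_ord_lt x t : \sum_(j < x | j < t) 1 = minn x t.
Proof.
rewrite big_mkcond; elim: x => [|x IHx]; first by rewrite big_ord0 min0n.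
by rewrite big_ord_recr /= IHx; case: ltnP; lia.
Qed.

Lemma card_first_columns t :
  #|[set c : cell lam | cell_col c < t]| = first_columns lam t.
Proof.
rewrite -sum1dep_card /first_columns (big_nth 0) big_mkord.
rewrite (eq_bigr (fun i : 'I_(size lam) => \sum_(j < nth 0 lam i | j < t) 1)).
  by rewrite sig_big_dep /=.
by move=> i _; rewrite sum_ord_lt.
Qed.

Lemma card_cell : #|{: cell lam}| = n.
Proof.
rewrite -[in RHS](sumn_partition lam) sumnE -cardsT.
rewrite (_ : setT = [set c : cell lam | cell_col c < n.+1]).
  rewrite card_first_columns; apply: eq_big_seq => x /leq_part le_xn.
  by apply/minn_idPl; apply: leqW.
apply/setP => c; rewrite !inE ltnS; apply/esym.
apply: leq_trans (ltnW (cell_in c)) _; apply: leq_part; apply: mem_nth.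
exact: ltn_ord (tag c).
Qed.

Lemma TabP (T : {ffun cell lam -> 'I_n}) : reflect (injective T) (T \in Tab lam).
Proof.
rewrite inE; apply: (iffP andP) => [[/injectiveP]//|injT]; split.
  exact/injectiveP.
apply/forallP => i; apply/existsP.
have /codomP[c ->] : i \in codom T; last by exists c.
by apply: inj_card_onto => //; rewrite card_cell card_ord.
Qed.

Lemma Tab_surj T : T \in Tab lam -> forall i, exists c, T c = i.
Proof.
by rewrite inE => /andP[_ /forallP surT] i; have /existsP[c /eqP] := surT i; exists c.
Qed.

Lemma Tab_bij T : T \in Tab lam -> bijective T.
Proof.
by move/TabP=> injT; apply: inj_card_bij => //; rewrite card_cell card_ord.
Qed.

(** A tableau is determined up to the order within its columns by the column
    of each entry; here the entries of a column are put in increasing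
    order. *)
Lemma exists_tableau (col : 'I_n -> nat) :
    (forall k : nat, multiplicity col k = column_height lam k) ->
  exists2 T, T \in Tab lam & forall c : cell lam, col (T c) = cell_col c.
Proof.
move=> col_lam; pose E k := [seq i <- enum 'I_n | col i == k].
have size_E k : size (E k) = column_height lam k.
  rewrite -col_lam size_filter -sum1_count big_mkcond big_enum /=.
  by apply: eq_bigr => i _; case: eqP.
have uE k : uniq (E k) by rewrite filter_uniq ?enum_uniq.
have /fin_all_exists[T TE] (c : cell lam) :
    exists i, col i = cell_col c /\ index i (E (cell_col c)) = cell_row c.
  have lt_c : cell_row c < size (E (cell_col c)).
    by rewrite size_E column_height_gt cell_in.
  have [i0 _] : exists i0 : 'I_n, true by case: (E _) lt_c => // i; exists i.
  exists (nth i0 (E (cell_col c)) (cell_row c)); split; last by rewrite index_uniq.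
  by have := mem_nth i0 lt_c; rewrite mem_filter => /andP[/eqP].
exists [ffun c => T c]; last by move=> c; rewrite ffunE; have [] := TE c.
apply/TabP => c d; rewrite !ffunE => Ecd.
have [cc rc] := TE c; have [cd rd] := TE d.
have Ecol : cell_col c = cell_col d by rewrite -cc -cd Ecd.
by apply: cell_inj => //; rewrite -rc -rd Ecd Ecol.
Qed.

End Cells.

Local Open Scope ring_scope.

(** * Monomials of polynomials vanishing on orbit types *)

Definition majorization_filter n (F : {set partition_of n}) : Prop :=
  forall lam mu : partition_of n, lam \in F -> majorizes lam mu -> mu \in F.

Lemma lower_filter_majorization n (F : {set partition_of n}) :
  lower_filter F -> majorization_filter F.
Proof. by move=> lowF lam mu lamF /majorizes_dominates; apply: lowF. Qed.

(** The filter that governs the leading coefficient, when a polynomial of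
    degree d in its last variable vanishes on the orbit types outside F. *)
Definition add_cell_preim n (F : {set partition_of n.+1}) d :
  {set partition_of n} := [set mu | add_cell_row mu d \in F].

Lemma lower_add_cell_preim n (F : {set partition_of n.+1}) d :
  majorization_filter F -> majorization_filter (add_cell_preim F d).
Proof.
move=> lowF lam mu; rewrite !inE => lamF /(majorizes_add_cell d).
exact: lowF.
Qed.

Section LastVariable.
Variables (K : fieldType) (n : nat).
Implicit Types (f : {mpoly K[n.+1]}) (a : 'I_n -> K).

Lemma muni_eval f a z : (map_poly (meval a) (muni f)).[z] = f.@[extend a z].
Proof.
rewrite muniE mevalE rmorph_sum horner_sum; apply: eq_bigr => m _.
rewrite -mul_polyC rmorphM /= map_polyC /= map_polyXn hornerM hornerC hornerXn.
rewrite mevalZ mevalX -mulrA big_ord_recr /= extend_max; congr (_ * (_ * _)).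
by apply: eq_bigr => i _; rewrite extend_widen mnmE.
Qed.

Lemma muni_coef f (m : 'X_{1..n}) d :
  ((muni f)`_d)@_m = f@_[multinom extend m d i | i < n.+1].
Proof.
rewrite muniE coef_sum raddf_sum /= [in RHS](mpolyE f) raddf_sum /=.
apply: eq_bigr => k _; rewrite coefZ coefXn mulr_natr mcoeffMn !mcoeffZ !mcoeffX.
rewrite -mulrnAr -mulrnA; congr (_ * _%:R).
case: (altP (k =P _)) => [->|ne_k].
  rewrite mnmE extend_max eqxx muln1.
  by apply/eqP; rewrite eqb1; apply/eqP/mnmP => i; rewrite !mnmE extend_widen.
apply/eqP; rewrite muln_eq0 !eqb0 -negb_and; apply: contra ne_k.
case/andP=> /eqP/mnmP Em /eqP Ed; apply/eqP/mnmP => i; rewrite mnmE /extend.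
case: unliftP => [j ->|->] /=; last by [].
rewrite -(Em j) mnmE; congr (k _); apply: val_inj.
by rewrite /= /bump leqNgt ltn_ord.
Qed.

Lemma muni_eq0 f : muni f = 0 -> f = 0.
Proof.
move=> f0; apply/mpolyP => m; rewrite mcoeff0.
transitivity ((muni f)`_(m ord_max))@_[multinom m (widen_ord (leqnSn n) i) | i < n].
  rewrite muni_coef; congr (_@__); apply/mnmP => i; rewrite mnmE /extend.
  case: unliftP => [j ->|->] //=; rewrite mnmE; congr (m _); apply: val_inj.
  by rewrite /= /bump leqNgt ltn_ord.
by rewrite f0 coef0 mcoeff0.
Qed.

Lemma infinite_uniq : infinite_field K ->
  forall k, exists2 s : seq K, uniq s & size s = k.
Proof.
move=> infK; elim=> [|k [s us <-]]; first by exists [::].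
by have [x xs] := infK s; exists (x :: s); rewrite //= xs.
Qed.

(** At a point a of orbit type mu outside the new filter, f(a, z) vanishes for
    every z whose multiplicity in a is at least v = mu_d.  There are at least
    d + 1 such z: the values belonging to the rows 0, ..., d of mu if v > 0,
    and all of K if v = 0. *)
Lemma vanishing_lead_coef (F : {set partition_of n.+1}) f d :
    infinite_field K -> majorization_filter F -> vanishing_ideal K (~: F) f ->
    (size (muni f) <= d.+1)%N ->
  vanishing_ideal K (~: add_cell_preim F d) (muni f)`_d.
Proof.
move=> infK lowF fF size_f mu; rewrite !inE => muF a Ea.
set v := nth 0%N mu d; pose p := map_poly (meval a) (muni f).
have root_p z : (v <= multiplicity a z)%N -> root p z.
  move=> le_vz; rewrite /root muni_eval (fF (orbit_type (extend a z))) //.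
  rewrite inE; apply: contra muF => /lowF; apply=> t.
  rewrite first_columns_add_cell ?nth_row_or0 // first_columns_extend Ea.
  by rewrite leq_add2l -/v; case: ltnP => //= lt_t; rewrite (leq_ltn_trans le_vz).
have [rs [u_rs size_rs p_rs]] :
    exists rs, [/\ uniq rs, (d < size rs)%N & all (root p) rs].
  case: (posnP v) => [v0|v_gt0].
    have [rs u_rs size_rs] := infinite_uniq infK d.+1.
    by exists rs; split=> //; [rewrite size_rs | apply/allP => z _; rewrite root_p ?v0].
  exists [seq x <- undup (codom a) | (v <= multiplicity a x)%N]; split.
  - by rewrite filter_uniq ?undup_uniq.
  - have : (d < column_height mu v.-1)%N by rewrite column_height_gt prednK.
    rewrite /column_height -Ea /= (seq.permP (permEl (perm_sort _ _))) count_map.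
    rewrite size_filter; congr (_ < _)%N; apply: eq_count => x /=.
    by rewrite count_codom prednK.
  - by apply/allP => x; rewrite mem_filter => /andP[/root_p].
(* The degree of p is at most d, and p has more than d roots. *)
have p0 : p = 0.
  apply/eqP; apply: contraLR size_f => p_neq0; rewrite -ltnNge.
  have := max_poly_roots p_neq0 p_rs u_rs.
  move/(leq_ltn_trans size_rs)/leq_trans; apply.
  exact: size_poly.
by rewrite -coef_map -/p p0 coef0.
Qed.

End LastVariable.

(** The tableau is represented by the column of each entry: its Specht
    polynomial has, for the order in which larger indices are larger
    variables, an initial monomial where the exponent of the variable i is
    the number of smaller entries in the column of i. *)
Lemma vanishing_has_specht_monomial (K : fieldType) n
    (F : {set partition_of n}) (f : {mpoly K[n]}) :
    infinite_field K -> majorization_filter F -> vanishing_ideal K (~: F) f ->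
    f != 0 ->
  exists (m : 'X_{1..n}) (lam : partition_of n) (col : 'I_n -> nat),
    [/\ m \in msupp f, lam \in F,
        forall c : nat, multiplicity col c = column_height lam c
      & forall i : 'I_n, (\sum_(j < n | (j < i)%N) (col j == col i) <= m i)%N].
Proof.
move=> infK; elim: n => [|n IHn] in F f *.
  move=> _ fF f_neq0; have f0 : f = (f@_0%MM)%:MP.
    apply/mpolyP => m; rewrite mcoeffC (_ : m = 0%MM) ?eqxx ?mulr1 //.
    by apply/mnmP => -[].
  pose a (i : 'I_0) : K := 0.
  have c_neq0 : f@_0%MM != 0 by apply: contraNneq f_neq0 => c0; rewrite f0 c0.
  (* The polynomial is a nonzero constant, so the only orbit type is in F. *)
  exists 0%MM, (orbit_type a), (fun=> 0%N); split=> [||c|[] //].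
  - by rewrite mcoeff_msupp.
  - apply: contraR c_neq0; rewrite -in_setC => /fF/(_ a erefl).
    by rewrite {1}f0 mevalC => ->.
  - rewrite /multiplicity big_ord0; have := size_partition (orbit_type a).
    by rewrite leqn0 => /nilP ->.
move=> lowF fF f_neq0; pose d := (size (muni f)).-1.
have muni_neq0 : muni f != 0 by apply: contra_neq f_neq0; apply: muni_eq0.
have size_f : size (muni f) = d.+1 by rewrite prednK // size_poly_gt0.
have /IHn := vanishing_lead_coef infK lowF fF (eq_leq size_f).
case/(_ (lower_add_cell_preim lowF)); first by rewrite lead_coef_eq0.
move=> m [mu [col [m_f muF col_mu col_m]]].
set v := nth 0%N mu d.
exists [multinom extend m d i | i < n.+1], (add_cell_row mu d), (extend col v).
split.
- by move: m_f; rewrite !mcoeff_msupp muni_coef.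
- by move: muF; rewrite inE.
- by move=> c; rewrite column_height_add_cell ?nth_row_or0 // multiplicity_extend col_mu.
move=> i; rewrite mnmE big_mkcond big_ord_recr /=.
case: (unliftP ord_max i) => [j|] ->.
  have -> : lift ord_max j = widen_ord (leqnSn n) j.
    by apply: val_inj; rewrite /= /bump leqNgt ltn_ord.
  rewrite !extend_widen /= ltnNge (ltnW (ltn_ord j)) addn0 -big_mkcond /=.
  by apply: leq_trans (col_m j); apply/eq_leq/eq_bigr => k _; rewrite extend_widen.
(* The new exponent d is at least the number of cells above the new one. *)
rewrite !extend_max ltnn addn0; apply: (@leq_trans (multiplicity col v)).
  apply/eq_leq/eq_bigr => j _; rewrite extend_widen /=.
  by rewrite ltn_ord.
by rewrite col_mu leqNgt column_height_gt ltnn.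
Qed.

(** * Specht polynomials: zeros and initial monomials *)

(** Among the cells of the first t columns, a given value of a occurs at most
    once per column, hence at most t times, and never more often than its
    multiplicity. *)
Lemma specht_eval_neq0 (K : fieldType) n (lam : partition_of n) T
    (a : 'I_n -> K) :
  T \in Tab lam -> (specht K T).@[a] != 0 -> majorizes lam (orbit_type a).
Proof.
move=> TT fa_neq0.
have col_distinct c d : cell_col c = cell_col d -> a (T c) = a (T d) -> c = d.
  wlog le_cd : c d / (cell_row c <= cell_row d)%N => [hw|] Ecol Ea.
    have [le_cd|/ltnW le_dc] := leqP (cell_row c) (cell_row d); first exact: hw.
    exact/esym/hw.
  apply: cell_inj => //; apply/eqP; move: le_cd; rewrite leq_eqVlt.
  case/orP=> // lt_cd; case/negP: fa_neq0.
  rewrite /specht (bigD1 c) //= (bigD1 d) ?Ecol ?eqxx //=.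
  by rewrite !mevalM mevalB !mevalXU Ea subrr !mul0r.
move=> t; rewrite -card_first_columns -sum1dep_card.
rewrite (@first_columns_orbit _ _ _ (undup (codom a))) ?undup_uniq //; last first.
  by move=> x; rewrite mem_undup.
rewrite (eq_bigr (fun c => \sum_(x <- undup (codom a)) (a (T c) == x)))%N; last first.
  move=> c _; rewrite (bigD1_seq (a (T c))) ?undup_uniq ?mem_undup ?codom_f //=.
  by rewrite eqxx big1 ?addn0 // => x; rewrite eq_sym => /negbTE ->.
rewrite exchange_big /=; apply: leq_sum => x _; rewrite leq_min; apply/andP; split.
  rewrite /multiplicity (reindex _ (onW_bij _ (Tab_bij TT))) /= big_mkcond /=.
  by apply: leq_sum => c _; case: ifP.
rewrite -big_mkcondr sum1dep_card.
set A := [set c | _].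
have col_lt (c : cell lam) : c \in A -> (cell_col c < t)%N by rewrite inE => /andP[].
case: t => [|t] in A col_lt *.
  by rewrite leqn0 cards_eq0; apply/eqP/setP => c; rewrite !inE ltn0.
rewrite -(card_in_imset (f := fun c => inord (cell_col c) : 'I_t.+1)).
  by apply: leq_trans (max_card _) _; rewrite card_ord.
move=> c d cA dA /(congr1 val); rewrite /= !inordK ?col_lt // => Ecd.
apply: col_distinct => //; move: cA dA; rewrite !inE.
by move=> /andP[_ /eqP->] /andP[_ /eqP->].
Qed.

Section Leading.
Variables (K : fieldType) (n : nat) (le : rel 'X_{1..n}).
Hypothesis mo : monomial_order le.
Implicit Types (f g : {mpoly K[n]}) (m : 'X_{1..n}) (i j k : 'I_n).

(** The degree condition keeps the division below inside a finite set of
    monomials, so that it terminates for every monomial order. *)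
Definition is_lead f m : Prop :=
  f@_m != 0 /\ forall m', m' \in msupp f -> le m' m && (mdeg m' == mdeg m).

Lemma is_lead1 : is_lead 1 0%MM.
Proof.
split; first by rewrite mcoeff1 eqxx oner_eq0.
by move=> m; rewrite msupp1 inE => /eqP ->; rewrite (mo_refl mo) eqxx.
Qed.

Lemma le_addr m1 m2 m : le m1 m2 -> le (m1 + m)%MM (m2 + m)%MM.
Proof. by rewrite ![(_ + m)%MM]addmC; apply: (mo_add mo). Qed.

Lemma is_leadM f g m1 m2 :
  is_lead f m1 -> is_lead g m2 -> is_lead (f * g) (m1 + m2)%MM.
Proof.
move=> [f_m1 le_f] [g_m2 le_g]; split; last first.
  move=> m /msuppM_le/allpairsP[[k1 k2] /=].
  move=> [/le_f/andP[le1 /eqP d1] /le_g/andP[le2 /eqP d2] ->].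
  rewrite !mdegD d1 d2 eqxx andbT; apply: (mo_trans mo) (le_addr _ le1).
  exact: (mo_add mo).
have lt1 : (mdeg m1 < (mdeg (m1 + m2)).+1)%N by rewrite mdegD; lia.
have lt2 : (mdeg m2 < (mdeg (m1 + m2)).+1)%N by rewrite mdegD; lia.
rewrite mcoeffM (bigD1 (BMultinom lt1, BMultinom lt2)) //=.
rewrite big1 ?addr0 ?mulf_neq0 // => -[k1 k2] /= /andP[/eqP Ek ne_k].
have [/eqP|] := boolP (f@_k1 * g@_k2 == 0) => //.
rewrite mulf_eq0 negb_or -!mcoeff_msupp.
move=> /andP[/le_f/andP[le1 _] /le_g/andP[le2 _]].
have E1 : bmnm k1 = m1.
  have : (k1 + m2 = m1 + m2)%MM.
    apply: (mo_anti mo); rewrite le_addr //=.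
    by have := mo_add mo k1 le2; rewrite -Ek.
  exact: addIm.
have E2 : bmnm k2 = m2 by move: Ek; rewrite E1 => /addmI.
by case/eqP: ne_k; congr (_, _); apply: val_inj.
Qed.

Lemma is_lead_init f m : is_lead f m -> init_mnm le f = m.
Proof.
case; rewrite -mcoeff_msupp /init_mnm => m_f le_f.
have {}le_f m' : m' \in msupp f -> le m' m by case/le_f/andP.
elim: (msupp f) m_f le_f => // m' s IHs; rewrite big_cons inE => m_s le_s.
have le_big :
    le (\big[(fun m1 m2 => if le m1 m2 then m2 else m1)/0%MM]_(k <- s) k) m.
  rewrite big_seq; elim/big_ind: _ => [||k ks]; first exact: (mo_min mo).
    by move=> x y lx ly; case: ifP.
  by apply: le_s; rewrite inE ks orbT.
case: (boolP (m \in s)) m_s => [ms _|ms].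
  rewrite IHs // => [|k ks]; last by apply: le_s; rewrite inE ks orbT.
  by rewrite le_s ?mem_head.
rewrite orbF => /eqP Em; rewrite -Em; case: ifP => // le_m.
by apply: (mo_anti mo); rewrite le_m andbT.
Qed.

Lemma init_mnmP f : f != 0 ->
  init_mnm le f \in msupp f /\ forall m, m \in msupp f -> le m (init_mnm le f).
Proof.
rewrite -msupp_eq0 /init_mnm.
elim: (msupp f) => // m s IHs _; rewrite big_cons.
case: s IHs => [_|m' s /(_ isT)].
  rewrite big_nil; split.
    rewrite !inE; case: ifP => // le_m0.
    by apply/eqP/(mo_anti mo); rewrite (mo_min mo) le_m0.
  by move=> k; rewrite inE => /eqP ->; case: ifP => //; rewrite (mo_refl mo).
set b := \big[_/_]_(_ <- _) _; move=> [b_s le_b]; split.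
  by case: ifP; rewrite inE ?eqxx // b_s orbT.
move=> k; rewrite inE => /predU1P[->|/le_b le_kb].
  by case: ifP => //; rewrite (mo_refl mo).
case: ifPn => // /negbTE le_mb; apply: (mo_trans mo) le_kb _.
by have := mo_total mo m b; rewrite le_mb.
Qed.

Definition var_max i j : 'I_n := if le U_(i)%MM U_(j)%MM then j else i.

Lemma is_lead_varB i j : i != j -> is_lead ('X_i - 'X_j) U_(var_max i j)%MM.
Proof.
move=> ne_ij; split.
  rewrite mcoeffB !mcoeffXU /var_max; case: ifP => _; rewrite eqxx.
    by rewrite (negbTE ne_ij) sub0r oppr_eq0 oner_eq0.
  by rewrite (eq_sym j) (negbTE ne_ij) subr0 oner_eq0.
move=> m /msuppB_le; rewrite mem_cat !msuppX !inE /var_max.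
case/orP=> /eqP ->; rewrite ?mdeg1; case: ifP; rewrite ?(mo_refl mo) ?mdeg1 ?eqxx //.
  by move=> ->.
by have := mo_total mo U_(i)%MM U_(j)%MM; case/orP=> -> //.
Qed.

(** The initial monomial of a Specht polynomial: each of its factors
    contributes the larger of its two variables. *)
Definition specht_mnm (lam : partition_of n) (T : {ffun cell lam -> 'I_n}) :
    'X_{1..n} :=
  (\sum_(c : cell lam)
     \sum_(d : cell lam | (cell_col c == cell_col d)
                          && (cell_row c < cell_row d)%N)
       U_(var_max (T c) (T d)))%MM.

Lemma specht_lead (lam : partition_of n) (T : {ffun cell lam -> 'I_n}) :
  T \in Tab lam -> is_lead (specht K T) (specht_mnm T).
Proof.
move=> /TabP injT; rewrite /specht /specht_mnm.
elim/big_ind2: _ => [||c _]; [exact: is_lead1 | by move=> *; apply: is_leadM|].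
elim/big_ind2: _ => [||d /andP[_ lt_cd]].
- exact: is_lead1.
- by move=> *; apply: is_leadM.
- by apply: is_lead_varB; apply: contraTneq lt_cd => /injT ->; rewrite ltnn.
Qed.

(** The variable k is contributed by the pairs made of k and a smaller variable
    of its column, so sending a pair to its other member is injective. *)
Lemma specht_mnm_le (lam : partition_of n) (T : {ffun cell lam -> 'I_n})
    (col : 'I_n -> nat) k :
    T \in Tab lam -> (forall c : cell lam, col (T c) = cell_col c) ->
  (specht_mnm T k <=
     \sum_(j | (j != k) && le U_(j)%MM U_(k)%MM) (col j == col k))%N.
Proof.
move=> TT colT; have injT := TabP _ TT; have [e Ek] := Tab_surj TT k.
rewrite /specht_mnm mnm_sumE.
under eq_bigr => c _ do rewrite mnm_sumE.
rewrite pair_big_dep /=.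
under eq_bigr => p _ do rewrite mnmE.
rewrite -big_mkcondr /= -[X in (_ <= X)%N]big_mkcondr !sum1dep_card /=.
set A := [set _ | _]; set B := [set _ | _].
pose other (p : cell lam * cell lam) := if T p.1 == k then T p.2 else T p.1.
have A_e p : p \in A ->
    [/\ cell_col p.1 = cell_col p.2, (cell_row p.1 < cell_row p.2)%N,
       (p.1 == e) || (p.2 == e) & var_max (T p.1) (T p.2) = k].
  rewrite inE => /andP[/andP[/eqP -> ->] /eqP Emax]; split=> //.
  by move: Emax; rewrite -Ek /var_max; case: ifP => _ /injT ->; rewrite eqxx ?orbT.
rewrite -(card_in_imset (f := other)).
  apply/subset_leq_card/subsetP => j.
  move=> /imsetP[[c d] /A_e[/= Ecol lt_cd e_cd Emax] ->].
  have ne_cd : c != d by apply: contraTneq lt_cd => ->; rewrite ltnn.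
  move: e_cd Emax; rewrite inE /other /= /var_max -Ek !(inj_eq injT).
  have [Ec _|ne_ce /= /eqP Ed] := eqVneq c e.
    rewrite {}Ec in Ecol ne_cd lt_cd *.
    case: ifPn => [_ /injT Ed|nle _]; first by rewrite Ed eqxx in ne_cd.
    rewrite (inj_eq injT) eq_sym ne_cd !colT Ecol eqxx andbT /=.
    by have := mo_total mo U_(T e)%MM U_(T d)%MM; rewrite (negbTE nle).
  rewrite Ed in Ecol lt_cd *.
  case: ifPn => [_ _|_ /injT Ec]; last by rewrite Ec eqxx in ne_ce.
  by rewrite (inj_eq injT) ne_ce !colT Ecol eqxx.
move=> [c d] [c' d'] /A_e[/= Ecol lt_cd e_cd _] /A_e[/= Ecol' lt_cd' e_cd' _].
rewrite /other /= -Ek !(inj_eq injT).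
have [Ec|ne_c] := eqVneq c e; have [Ec'|ne_c'] := eqVneq c' e => /injT E.
- by rewrite Ec Ec' E.
- move: e_cd'; rewrite (negbTE ne_c') => /eqP Ed'; move: lt_cd lt_cd'.
  by rewrite E Ec Ed' => /ltnW; rewrite leqNgt => /negbTE ->.
- move: e_cd; rewrite (negbTE ne_c) => /eqP Ed; move: lt_cd lt_cd'.
  by rewrite E Ec' Ed => /ltnW; rewrite leqNgt => /negbTE ->.
- move: e_cd e_cd'; rewrite (negbTE ne_c) (negbTE ne_c') => /eqP Ed /eqP Ed'.
  by rewrite Ed Ed' E.
Qed.

(** Reduces an arbitrary order of the variables to the order of their indices,
    for which the existence of a suitable monomial was proved by induction. *)
Lemma var_rank :
  exists s : 'S_n, forall i j, (s i <= s j)%N -> le U_(i)%MM U_(j)%MM.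
Proof.
pose r i j := le U_(i)%MM U_(j)%MM; pose t := sort r (enum 'I_n).
have t_mem i : i \in t by rewrite mem_sort mem_enum.
have sz_t : size t = n by rewrite size_sort size_enum_ord.
have lt_t i : (index i t < n)%N by rewrite -[X in (_ < X)%N]sz_t index_mem.
have inj_t : injective (fun i => Ordinal (lt_t i)).
  by move=> i j /(congr1 val) /=; apply: index_inj; rewrite ?t_mem.
exists (perm inj_t) => i j; rewrite !permE /=.
have r_trans : transitive r by move=> x y z; apply: (mo_trans mo).
have r_refl : reflexive r by move=> x; apply: (mo_refl mo).
have r_total : total r by move=> x y; apply: (mo_total mo).
have sorted_t : sorted r t by apply: sort_sorted.
exact: (sorted_leq_index r_trans r_refl sorted_t i j (t_mem i) (t_mem j)).
Qed.

Lemma vanishing_perm (F : {set partition_of n}) f (s : 'S_n) :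
  vanishing_ideal K F f -> vanishing_ideal K F (msym s f).
Proof.
move=> fF mu muF a Ea.
have -> : (msym s f).@[a] = f.@[a \o s].
  rewrite /msym {1}/mmap raddf_sum mevalE; apply: eq_bigr => m _ /=.
  rewrite mevalM mevalC /mmap1 rmorph_prod; congr (_ * _).
  by apply: eq_bigr => i _; rewrite rmorphXn /= mevalXU.
by apply: (fF mu) => //; rewrite orbit_type_perm.
Qed.

Lemma vanishing_specht_mnm (F : {set partition_of n}) f :
    infinite_field K -> majorization_filter F -> vanishing_ideal K (~: F) f ->
    f != 0 ->
  exists m (lam : partition_of n) (T : {ffun cell lam -> 'I_n}),
    [/\ m \in msupp f, lam \in F, T \in Tab lam & (specht_mnm T <= m)%MM].
Proof.
move=> infK lowF fF f_neq0; have [s s_le] := var_rank.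
have sf_neq0 : msym s f != 0.
  by apply: contra_neq f_neq0 => sf0; apply: (@inj_msym _ _ s); rewrite sf0 msym0.
have [m [lam [col [m_f lamF col_lam col_m]]]] :=
  vanishing_has_specht_monomial infK lowF (vanishing_perm s fF) sf_neq0.
have col_s c : multiplicity (col \o s) c = column_height lam c.
  by rewrite -col_lam /multiplicity [RHS](reindex_inj (@perm_inj _ s)).
have [T TT colT] := exists_tableau col_s.
exists [multinom m (s i) | i < n], lam, T; split=> //.
  by rewrite mcoeff_msupp -mcoeff_sym -mcoeff_msupp.
apply/mnm_lepP => k; rewrite mnmE; apply: leq_trans (specht_mnm_le k TT colT) _.
apply: leq_trans (col_m (s k)).
rewrite [X in (_ <= X)%N](reindex_inj (@perm_inj _ s)) /=.
rewrite big_mkcond [X in (_ <= X)%N]big_mkcond; apply: leq_sum => j _.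
case: ifP => // /andP[ne_jk le_jk]; rewrite ifT // ltnNge; apply: contra ne_jk.
move/s_le => le_kj; have /mnmP/(_ j) : U_(j)%MM = U_(k)%MM :> 'X_{1..n}.
  by apply: (mo_anti mo); rewrite le_jk.
by rewrite !mnm1E eqxx eq_sym; case: eqP.
Qed.

End Leading.

(** * Ideals, division and Groebner bases *)

Section Ideals.
Variable R : comNzRingType.
Implicit Types (A I : R -> Prop) (f g : R).

Lemma ideal_gen_ideal A : is_ideal (ideal_gen A).
Proof.
split.
- by exists [::]; rewrite ?big_nil.
- move=> f g [s sA ->] [t tA ->]; exists (s ++ t); last by rewrite big_cat.
  by move=> x; rewrite mem_cat => /orP[/sA|/tA].
- move=> h f [s sA ->]; exists [seq (h * x.1, x.2) | x <- s].
    by move=> _ /mapP[x /sA Ax ->].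
  by rewrite big_map big_distrr /=; apply: eq_bigr => x _; rewrite mulrA.
Qed.

Lemma ideal_gen_mem A g : A g -> ideal_gen A g.
Proof.
move=> Ag; exists [:: (1, g)]; last by rewrite big_seq1 mul1r.
by move=> x; rewrite inE => /eqP ->.
Qed.

Lemma ideal_sum I (T : eqType) (s : seq T) (P : pred T) (F : T -> R) :
  is_ideal I ->
  (forall x, x \in s -> P x -> I (F x)) -> I (\sum_(x <- s | P x) F x).
Proof.
case=> I0 ID _ IF; rewrite big_seq_cond.
by elim/big_ind: _ => // x /andP[]; apply: IF.
Qed.

Lemma ideal_gen_min A I :
  is_ideal I -> (forall g, A g -> I g) -> forall f, ideal_gen A f -> I f.
Proof.
move=> idI AI f [s sA ->]; apply: ideal_sum => // x /sA /AI + _.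
by case: idI => _ _; apply.
Qed.

Lemma idealB I f g : is_ideal I -> I f -> I g -> I (f - g).
Proof.
by case=> _ ID IM If Ig; apply: ID => //; rewrite -mulN1r; apply: IM.
Qed.

End Ideals.

Section SpechtIdeals.
Variables (K : fieldType) (n : nat) (F : {set partition_of n}).

Lemma filter_ideal_ideal : is_ideal (filter_ideal K F).
Proof.
have idS lam := ideal_gen_ideal
  (fun f => exists2 T, T \in Tab lam & f = specht K (n := n) T).
split.
- by exists (fun=> 0); rewrite ?big1 // => lam _; case: (idS lam).
- move=> f g [p pF ->] [q qF ->]; exists (fun lam => p lam + q lam).
    by move=> lam lamF; case: (idS lam) => _ ID _; apply: ID; [apply: pF | apply: qF].
  by rewrite big_split.
- move=> h f [q qF ->]; exists (fun lam => h * q lam); last by rewrite big_distrr.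
  by move=> lam lamF; case: (idS lam) => _ _; apply; apply: qF.
Qed.

Lemma specht_filter_ideal lam (T : {ffun cell lam -> 'I_n}) :
  lam \in F -> T \in Tab lam -> filter_ideal K F (specht K T).
Proof.
move=> lamF TT; exists (fun mu => if mu == lam then specht K T else 0).
  move=> mu _; case: eqP => [->|_]; first by apply: ideal_gen_mem; exists T.
  by case: (ideal_gen_ideal (fun f => exists2 T, T \in Tab mu & f = specht K T)).
by rewrite (bigD1 lam) //= eqxx big1 ?addr0 // => mu /andP[_ /negbTE->].
Qed.

Lemma filter_ideal_min (I : {mpoly K[n]} -> Prop) : is_ideal I ->
    (forall lam (T : {ffun cell lam -> 'I_n}),
       lam \in F -> T \in Tab lam -> I (specht K T)) ->
  forall f, filter_ideal K F f -> I f.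
Proof.
move=> idI TI f [q qF ->]; apply: ideal_sum => // lam _ lamF.
by apply: ideal_gen_min (qF lam lamF) => // _ [T TT ->]; apply: TI.
Qed.

Lemma vanishing_ideal_radical (G : {set partition_of n}) :
  is_radical_ideal (vanishing_ideal K G).
Proof.
split=> [|f k fk mu muG a Ea].
  split=> [mu _ a _|f g fG gG mu muG a Ea|h f fG mu muG a Ea].
  - by rewrite meval0.
  - by rewrite mevalD (fG mu) ?(gG mu) ?addr0.
  - by rewrite mevalM (fG mu) ?mulr0.
have /eqP := fk mu muG a Ea; rewrite rmorphXn expf_eq0 => /andP[_ /eqP //].
Qed.

Lemma filter_ideal_vanishing f :
  majorization_filter F -> filter_ideal K F f -> vanishing_ideal K (~: F) f.
Proof.
move=> lowF; apply: filter_ideal_min => [|lam T lamF TT mu].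
  by case: (vanishing_ideal_radical (~: F)).
rewrite inE => muF a Ea; apply/eqP; apply: contraR muF.
by move=> /(specht_eval_neq0 TT); rewrite Ea; apply: lowF.
Qed.

End SpechtIdeals.

Section Division.
Variables (K : fieldType) (n : nat) (le : rel 'X_{1..n}).
Hypothesis mo : monomial_order le.
Variables (I : {mpoly K[n]} -> Prop) (std : pred 'X_{1..n}).
Hypothesis idI : is_ideal I.
Hypothesis reducible : forall m, ~~ std m ->
  exists g mg, [/\ I g, is_lead le g mg & (mg <= m)%MM].

Lemma normal_form_sum (s : seq 'X_{1..n}) (a : 'X_{1..n} -> K) :
    (forall m, m \in s -> exists2 r, I ('X_[m] - r) &
       forall m', m' \in msupp r -> std m' /\ le m' m) ->
  exists2 r, I (\sum_(m <- s) a m *: 'X_[m] - r) &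
    forall m', m' \in msupp r -> std m' /\ exists2 m, m \in s & le m' m.
Proof.
case: idI => I0 ID IM; elim: s => [|m s IHs] nf.
  by exists 0; rewrite ?big_nil ?subr0 // => m; rewrite msupp0.
have [r1 I1 std1] := nf m (mem_head _ _).
have [|r2 I2 std2] := IHs.
  by move=> k ks; apply: nf; rewrite inE ks orbT.
exists (a m *: r1 + r2).
  rewrite big_cons opprD addrACA; apply: ID => //.
  by rewrite -scalerBr -mul_mpolyC; apply: IM.
move=> k /msuppD_le; rewrite mem_cat.
case/orP=> [/msuppZ_le/std1[std_k le_k]|/std2[std_k [k' k's le_k]]].
  by split=> //; exists m; rewrite ?mem_head.
by split=> //; exists k'; rewrite // inE k's orbT.
Qed.

(** Replacing a nonstandard monomial by smaller ones of the same degree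
    terminates, since only finitely many monomials have that degree. *)
Lemma normal_form_mnm m : exists2 r, I ('X_[m] - r) &
  forall m', m' \in msupp r -> std m' /\ le m' m.
Proof.
case: (idI) => I0 ID IM.
(* The bound b stays fixed in the induction, so the sets of smaller monomials
   live in one finite type. *)
have [b lt_b] : exists b, (mdeg m < b)%N by exists (mdeg m).+1.
pose below k := [set k' : 'X_{1..n < b} | le k' k].
have [N] := ubnP #|below m|; elim: N => // N IHN in m lt_b *; rewrite ltnS => le_N.
have [std_m|/reducible[g [mg [Ig [g_mg le_g] le_mg]]]] := boolP (std m).
  exists 'X_[m]; first by rewrite subrr.
  by move=> k; rewrite msuppX inE => /eqP ->; rewrite (mo_refl mo).
pose h := 'X_[m] - (g@_mg)^-1 *: (g * 'X_[m - mg]).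
have h_lt k : k \in msupp h -> [/\ le k m, k != m & mdeg k = mdeg m].
  move=> k_h; have ne_km : k != m.
    apply: contraTneq k_h => ->; rewrite mcoeff_msupp negbK mcoeffB mcoeffX eqxx.
    by rewrite mcoeffZ -[X in (_ * _)@_X](submK le_mg) mcoeffMX mulVf ?subrr.
  move: k_h => /msuppB_le; rewrite mem_cat msuppX inE (negbTE ne_km) /=.
  move/msuppZ_le; rewrite (perm_mem (msuppMX _ _)).
  move=> /mapP[k' /le_g/andP[le_k' /eqP d_k'] Ek].
  split=> //; rewrite Ek.
    by rewrite -[X in le _ X](submK le_mg); apply: (mo_add mo).
  by rewrite -[X in _ = mdeg X](submK le_mg) !mdegD d_k'.
have [|r Ir std_r] := @normal_form_sum (msupp h) (fun k => h@_k).
  move=> k /h_lt[le_km ne_km dk]; apply: IHN; first by rewrite dk.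
  apply: leq_trans le_N; apply/proper_card/properP; split.
    by apply/subsetP => k'; rewrite !inE => le_k; apply: (mo_trans mo) le_k le_km.
  exists (BMultinom lt_b); rewrite !inE ?(mo_refl mo) //=.
  by apply: contra ne_km => le_mk; apply/eqP/(mo_anti mo); rewrite le_km.
exists r; last first.
  move=> k /std_r[std_k [k' /h_lt[le_k' _ _] le_k]]; split=> //.
  exact: (mo_trans mo) le_k le_k'.
rewrite -mpolyE in Ir.
have -> : 'X_[m] - r = (h - r) + (g@_mg)^-1 *: (g * 'X_[m - mg]).
  by rewrite /h addrAC subrK.
by apply: ID => //; rewrite -mul_mpolyC mulrCA mulrC; apply: IM.
Qed.

Lemma normal_form (f : {mpoly K[n]}) : exists2 r, I (f - r) &
  forall m', m' \in msupp r -> std m' /\ exists2 m, m \in msupp f & le m' m.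
Proof.
have [|r Ir std_r] := @normal_form_sum (msupp f) (fun k => f@_k).
  by move=> m _; apply: normal_form_mnm.
by exists r; rewrite // -mpolyE in Ir.
Qed.

Variable J : {mpoly K[n]} -> Prop.
Hypothesis idJ : is_ideal J.
Hypothesis subIJ : forall f, I f -> J f.
Hypothesis J_nonstd : forall f, J f -> f != 0 ->
  exists2 m, m \in msupp f & ~~ std m.

Lemma normal_form_eq0 r : J r -> (forall m, m \in msupp r -> std m) -> r = 0.
Proof.
move=> Jr std_r; apply/eqP; apply: contraT => /(J_nonstd Jr)[m /std_r ->].
by [].
Qed.

Lemma mem_ideal_of_nonstd f : J f -> I f.
Proof.
move=> Jf; have [r Ir std_r] := normal_form f.
have r0 : r = 0.
  apply: normal_form_eq0; last by move=> m /std_r[].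
  by rewrite -[r](subKr f); apply: idealB => //; apply: subIJ.
by rewrite r0 subr0 in Ir.
Qed.

(** Dividing the other terms of f leaves only monomials below the initial one,
    so a standard initial monomial would remain in a nonzero normal form that
    is still in J. *)
Lemma init_nonstd f : J f -> f != 0 -> ~~ std (init_mnm le f).
Proof.
move=> Jf f_neq0; have [m_f le_f] := init_mnmP mo f_neq0.
set m := init_mnm le f in m_f le_f *; apply/negP => std_m.
pose h := f - f@_m *: 'X_[m].
have h_lt k : k \in msupp h -> le k m /\ k != m.
  rewrite (perm_mem (msupp_rem _ _)) mem_rem_uniq ?msupp_uniq // !inE.
  by case/andP=> ne_k /le_f.
have [r Ir std_r] := normal_form h.
have r_m : r@_m = 0.
  apply/eqP; apply: contraT; rewrite -mcoeff_msupp.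
  move=> /std_r[_ [k /h_lt[le_k ne_k] le_mk]].
  by case/eqP: ne_k; apply: (mo_anti mo); rewrite le_k.
have r'0 : f@_m *: 'X_[m] + r = 0.
  apply: normal_form_eq0.
    rewrite (_ : _ + r = f - (h - r)); first by apply: idealB => //; apply: subIJ.
    by rewrite /h !opprB addrA addrC; ring.
  move=> k /msuppD_le; rewrite mem_cat => /orP[/msuppZ_le|/std_r[]//].
  by rewrite msuppX inE => /eqP ->.
have /eqP := congr1 (mcoeff m) r'0.
rewrite mcoeffD mcoeffZ mcoeffX eqxx mulr1 r_m addr0 mcoeff0.
by apply/negP; rewrite -mcoeff_msupp.
Qed.

End Division.

Lemma exists_monomial_order n : exists le : rel 'X_{1..n}, monomial_order le.
Proof.
exists (fun m1 m2 => (m1 <= m2)%O); split.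
- exact: Order.POrderTheory.lexx.
- exact: Order.POrderTheory.le_anti.
- exact: Order.POrderTheory.le_trans.
- exact: Order.TotalTheory.le_total.
- exact: le0m.
- by move=> m m1 m2; rewrite lemc_add2r.
Qed.

(** The equality of ideals and the Groebner property come from the same
    division, so both are obtained for one monomial order at a time. *)
Lemma filter_ideal_groebner (K : fieldType) (n : nat)
    (F : {set partition_of n}) (le : rel 'X_{1..n}) :
    monomial_order le -> infinite_field K -> majorization_filter F ->
  (forall f, vanishing_ideal K (~: F) f -> filter_ideal K F f) /\
  groebner_basis le (filter_ideal K F) (specht_basis K F).
Proof.
move=> mo infK lowF.
pose std m := ~~ [exists lam in F, exists T : {ffun cell lam -> 'I_n},
  (T \in Tab lam) && (specht_mnm le T <= m)%MM].
have nonstdP m : reflect (exists lam (T : {ffun cell lam -> 'I_n}),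
    [/\ lam \in F, T \in Tab lam & (specht_mnm le T <= m)%MM]) (~~ std m).
  rewrite negbK; apply: (iffP existsP); last first.
    move=> [lam [T [lamF TT le_T]]]; exists lam; rewrite lamF.
    by apply/existsP; exists T; rewrite TT.
  by move=> [lam /andP[lamF /existsP[T /andP[TT le_T]]]]; exists lam, T.
have red m : ~~ std m ->
    exists g mg, [/\ filter_ideal K F g, is_lead le g mg & (mg <= m)%MM].
  move=> /nonstdP[lam [T [lamF TT le_T]]]; exists (specht K T), (specht_mnm le T).
  by split=> //; [apply: specht_filter_ideal | apply: specht_lead].
have idI := filter_ideal_ideal K F.
have [idJ _] := vanishing_ideal_radical K (~: F).
have subIJ f := @filter_ideal_vanishing K n F f lowF.
have J_nonstd f : vanishing_ideal K (~: F) f -> f != 0 ->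
    exists2 m, m \in msupp f & ~~ std m.
  move=> Jf /(vanishing_specht_mnm mo infK lowF Jf).
  move=> [m [lam [T [m_f lamF TT le_T]]]].
  by exists m => //; apply/nonstdP; exists lam, T.
split; first exact: (mem_ideal_of_nonstd mo idI red idJ subIJ J_nonstd).
have G_F g : g \in specht_basis K F -> filter_ideal K F g.
  case/allpairsPdep=> lam [T [lamF TT ->]]; apply: specht_filter_ideal.
    by rewrite mem_enum in lamF.
  by rewrite mem_enum in TT.
split=> // p; split; last first.
  apply: ideal_gen_min; first exact: ideal_gen_ideal.
  move=> _ [f [fG f_neq0] ->]; apply: ideal_gen_mem; exists f => //.
  by split=> //; apply: G_F.
apply: ideal_gen_min; first exact: ideal_gen_ideal.
move=> _ [f [fI f_neq0] ->].
have /nonstdP[lam [T [lamF TT le_T]]] :=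
  init_nonstd mo idI red idJ subIJ J_nonstd (subIJ f fI) f_neq0.
have leadT := @specht_lead K n le mo lam T TT.
have [_ _ initM] : is_ideal (init_ideal le (fun g => g \in specht_basis K F)).
  exact: ideal_gen_ideal.
rewrite -(submK le_T) mpolyXD; apply: initM.
apply: ideal_gen_mem; exists (specht K T); last by rewrite (is_lead_init mo leadT).
split; last by apply: contraTneq (leadT.1) => ->; rewrite mcoeff0 eqxx.
by apply/allpairsPdep; exists lam, T; rewrite !mem_enum.
Qed.

Theorem theorem1p1 (K : fieldType) (n : nat) (F : {set partition_of n}) :
  infinite_field K -> (0 < n)%N -> F != set0 -> lower_filter F ->
  ((forall f : {mpoly K[n]}, filter_ideal K F f <-> vanishing_ideal K (~: F) f)
   /\ is_radical_ideal (filter_ideal K F))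
  /\ universal_groebner_basis (filter_ideal K F) (specht_basis K F).
Proof.
move=> infK _ _ /lower_filter_majorization lowF.
have IJ f : filter_ideal K F f <-> vanishing_ideal K (~: F) f.
  split; first exact: filter_ideal_vanishing.
  have [le mo] := exists_monomial_order n.
  by have [sub _] := filter_ideal_groebner mo infK lowF; apply: sub.
split; last by move=> le mo; have [] := filter_ideal_groebner mo infK lowF.
split=> //; split=> [|f k]; first exact: filter_ideal_ideal.
have [_ radJ] := vanishing_ideal_radical K (~: F).
by move=> /IJ/radJ fJ; apply/IJ.
Qed.
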